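(* Let $a\in(0,\frac12]$, let $p\in L^1([0,1],\mathfrak B,\lambda)$ with $p\ge 0$, let $\mu(B)=\int_B p\,d\lambda$, and let $\alpha=\{\alpha_1,\alpha_2\}$ be a set of weight functions on $[0,1]$. Put $A_1(x)=\alpha_1(x)p(x)$ and $A_2(x)=\alpha_2(x)p(x)$. Let $\mu_S$ be the measure obtained from $\mu$ by the equipped $2$-transformation $\{S,\alpha\}$, $S=S(a)=S_1\cup S_2$. Then $\mu_S=\mu$ if and only if for $\lambda$-almost every $x\in[0,1]$ $$A_1((1-a)x)+\chi_{\left[\frac{1-2a}{1-a},1\right]}(x)\,A_1((1-a)x+a)+A_2((1-a)x+a)+\chi_{\left[0,\frac{a}{1-a}\right)}(x)\,A_2((1-a)x)=\frac{p(x)}{1-a}.$$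
   Context: $\lambda$ is Lebesgue measure on $[0,1]$, $\mathfrak B$ is the $\sigma$-field of Borel subsets of $[0,1]$, and $\chi_E$ is the indicator function of $E$. For $a\in(0,\frac12]$ define $S_1,S_2:[0,1]\to[0,1]$ by $$S_1(x)=\begin{cases}\frac{x}{1-a},&x\in[0,1-a),\\ \frac{x-a}{1-a},&x\in[1-a,1],\end{cases}\qquad S_2(x)=\begin{cases}\frac{x}{1-a},&x\in[0,a),\\ \frac{x-a}{1-a},&x\in[a,1].\end{cases}$$ The $2$-valued transformation is $S=S(a)=S_1\cup S_2$. A set of weight functions is a pair $\alpha=\{\alpha_1,\alpha_2\}$ with $\alpha_1,\alpha_2\in L^1([0,1],\mathfrak B,\lambda)$, $\alpha_1,\alpha_2\ge 0$ and $\alpha_1(x)+\alpha_2(x)\equiv 1$. Given $\mu=\int p\,d\lambda$, the measure $\mu_S$ is defined for $B\in\mathfrak B$ by $$\mu_S(B)=\int_{S_1^{-1}(B)}\alpha_1(x)p(x)\,d\lambda+\int_{S_2^{-1}(B)}\alpha_2(x)p(x)\,d\lambda.$$ *)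

(* Defs.v *)
From HB Require Import structures.
From mathcomp Require Import all_boot all_order all_algebra.
From mathcomp Require Import all_classical all_reals all_analysis.

Set Implicit Arguments.
Unset Strict Implicit.
Unset Printing Implicit Defensive.

Import Order.TTheory GRing.Theory Num.Theory.
Import numFieldNormedType.Exports.

Local Open Scope classical_set_scope.
Local Open Scope ring_scope.

(* The space [0,1] with its Borel sigma-field and Lebesgue measure is encoded
   inside R: points are reals of I01, Borel subsets of [0,1] are the measurable
   subsets of R included in I01, and functions on [0,1] are functions R -> R
   whose values outside I01 are irrelevant. *)
Definition I01 {R : realType} : set R := `[0, 1].

Definition lambda {R : realType} : {measure set (measurableTypeR R) -> \bar R} :=
  lebesgue_measure.

Definition L1 {R : realType} (f : R -> R) : Prop :=
  lambda.-integrable I01 (EFin \o f).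

Definition S1 {R : realType} (a x : R) : R :=
  if x < 1 - a then x / (1 - a) else (x - a) / (1 - a).

Definition S2 {R : realType} (a x : R) : R :=
  if x < a then x / (1 - a) else (x - a) / (1 - a).

Definition weight_functions {R : realType} (alpha1 alpha2 : R -> R) : Prop :=
  [/\ L1 alpha1, L1 alpha2,
      forall x, I01 x -> 0 <= alpha1 x,
      forall x, I01 x -> 0 <= alpha2 x
    & forall x, I01 x -> alpha1 x + alpha2 x = 1].

Definition measure_of_density {R : realType} (p : R -> R) (B : set R) : \bar R :=
  (\int[lambda]_(x in B) (p x)%:E)%E.

(* The preimages are intersected with I01 because T1 and T2 are transformations
   of [0,1] only. *)
Definition transformed_measure {R : realType} (T1 T2 alpha1 alpha2 p : R -> R)
    (B : set R) : \bar R :=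
  (\int[lambda]_(x in I01 `&` T1 @^-1` B) (alpha1 x * p x)%:E +
   \int[lambda]_(x in I01 `&` T2 @^-1` B) (alpha2 x * p x)%:E)%E.

Definition eq_measure01 {R : realType} (m1 m2 : set R -> \bar R) : Prop :=
  forall B : set (measurableTypeR R), measurable B -> B `<=` I01 -> m1 B = m2 B.

(* Main.v *)
(* Each branch of S1 and S2 is an affine map x |-> (x - b) / c with c = 1 - a, so
   by change of variables it sends the measure with density A on its domain E
   to the measure with density y |-> c * A (c * y + b) * \1_E (c * y + b).  Summing
   the four branches shows that mu_S has a density which, away from y = 1, is
   c times the left-hand side of the stated identity; and two densities define
   the same measure iff they agree almost everywhere. *)

Require Import Defs.
From HB Require Import structures.
From mathcomp Require Import all_boot all_order all_algebra.
From mathcomp Require Import all_classical all_reals all_analysis.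
From mathcomp Require Import measurable_realfun ring lra.

Import Order.TTheory GRing.Theory Num.Theory.
Import numFieldNormedType.Exports.

Local Open Scope classical_set_scope.
Local Open Scope ring_scope.

Lemma measurable_affine (R : realType) (c b : R) :
  measurable_fun (setT : set (measurableTypeR R))
    (fun x => c * x + b : measurableTypeR R).
Proof. by apply: measurable_funD => //; exact: measurable_funM. Qed.

Lemma preimage_affine_ocitv (R : realType) (c b x y : R) : 0 < c ->
  (fun u => c * u + b) @^-1` `]x, y] = `](x - b) / c, (y - b) / c]%classic.
Proof.
move=> c0; apply/seteqP; split => u /=;
  by rewrite !in_itv /= ltr_pdivrMr // ler_pdivlMr // ltrBlDr lerBrDr mulrC.
Qed.

(** Lebesgue measure is [c] times its image under [x |-> c * x + b]. By uniqueness this need only be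
    checked on half-open intervals, whose preimages have their length divided by [c]. *)
Lemma ge0_integral_affine (R : realType) (c b : R)
    (D : set (measurableTypeR R)) (f : measurableTypeR R -> \bar R) :
  0 < c -> measurable D -> measurable_fun D f ->
  (forall x, D x -> 0 <= f x)%E ->
  (\int[lambda]_(x in D) f x =
   c%:E * \int[lambda]_(x in (fun x => c * x + b)%R @^-1` D) f (c * x + b)%R)%E.
Proof.
move=> c0 mD mf f0.
have mphi := @measurable_affine R c b.
rewrite -(ge0_integral_pushforward mphi) //; last by move=> x /set_mem; exact: f0.
(* Packing [c] with its sign lets the factor be absorbed into the measure, so that only an equality
   of two measures remains. *)
rewrite -[c in RHS]/((NngNum (ltW c0))%:num) -ge0_integral_mscale //.
apply: eq_measure_integral => A mA _.
apply: lebesgue_measure_unique => // _ [[x y]] _ <-.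
rewrite -[RHS]/(c%:E * lebesgue_measure ((fun u => c * u + b)%R @^-1` `]x, y]%classic))%E.
rewrite preimage_affine_ocitv //.
rewrite !lebesgue_measure_itv /= !lte_fin ltr_pM2r ?invr_gt0 // ltrD2r.
case: ifP => _; rewrite ?mule0 // -!EFinD -EFinM; congr (_%:E).
by field; rewrite gt_eqF.
Qed.

(* Density of the image of the measure [f * \1_E] under [x |-> (x - b) / c]. *)
Definition branch_density {R : realType} (c b : R) (E : set R) (f : R -> R)
    (y : R) : R := c * (f \_ E) (c * y + b).

Lemma branch_density_ge0 (R : realType) (c b : R) (E : set R) (f : R -> R) :
  0 <= c -> (forall x, E x -> 0 <= f x) ->
  forall y, 0 <= branch_density c b E f y.
Proof. by move=> c0 f0 y; rewrite mulr_ge0 // restrict_ge0. Qed.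

Lemma measurable_branch_density (R : realType) (c b : R)
    (E D : set (measurableTypeR R)) (f : R -> R) :
  measurable E -> measurable_fun E f ->
  measurable_fun D (branch_density c b E f).
Proof.
move=> mE /(measurable_restrictT _ mE) mf; apply: measurable_funTS.
apply: measurable_funM => //.
by apply: (measurableT_comp mf); exact: measurable_affine.
Qed.

(** Extending [f] by zero off [E] moves the constraint [E] into the integrand. The substitution
    [x = c * y + b] then inverts the branch, so the remaining domain is exactly [B]. *)
Lemma ge0_integral_branch (R : realType) (c b : R)
    (E B : set (measurableTypeR R)) (f : R -> R) :
  0 < c -> measurable E -> measurable B -> measurable_fun E f ->
  (forall x, E x -> 0 <= f x) ->
  (\int[lambda]_(x in E `&` (fun x => (x - b) / c)%R @^-1` B) (f x)%:E =
   \int[lambda]_(x in B) (branch_density c b E f x)%:E)%E.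
Proof.
move=> c0 mE mB mf f0.
have mfE := (measurable_restrictT f mE).1 mf.
have fE0 x : 0 <= (f \_ E) x by exact: restrict_ge0.
have mphi : measurable_fun (setT : set (measurableTypeR R))
    (fun x => (x - b) / c : measurableTypeR R).
  by apply: measurable_funM => //; exact: measurable_funB.
have fK x : (c * x + b - b) / c = x by rewrite addrK mulrC mulKf ?gt_eqF.
have mphiB : measurable ((fun x => (x - b) / c)%R @^-1` B).
  by rewrite -[X in measurable X]setTI; exact: mphi.
rewrite setIC integral_mkcondr (restrict_EFin f).
rewrite [LHS](@ge0_integral_affine _ c b) //; last 2 first.
- exact/measurable_EFinP/measurable_funTS.
- by move=> x _; rewrite /= lee_fin.
have -> : (fun x => c * x + b)%R @^-1` ((fun x => (x - b) / c)%R @^-1` B) = B.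
  by apply/seteqP; split=> x /=; rewrite fK.
rewrite -ge0_integralZl //.
- apply/measurable_EFinP/measurable_funTS.
  by apply: (measurableT_comp mfE); exact: measurable_affine.
- by move=> x _; rewrite /= lee_fin.
- by rewrite lee_fin ltW.
Qed.

(** For [t] in [0,1], this is the density of the image of [f] under the map equal to [x / c] below
    [t] and to [(x - a) / c] from [t] on. With [c = 1 - a] that map is [S1 a] for [t = 1 - a] and
    [S2 a] for [t = a], so one computation serves both. *)
Definition two_branch_density {R : realType} (c a t : R) (f : R -> R)
    (y : R) : R :=
  branch_density c 0 `[0, t[ f y + branch_density c a `[t, 1] f y.

Lemma itv01_split (R : realType) (t : R) : 0 <= t <= 1 ->
  I01 = `[0, t[ `|` `[t, 1] :> set R.
Proof.
by case/andP=> t0 t1; rewrite /I01 -itv_bndbnd_setU ?bnd_simp.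
Qed.

Section TwoBranches.
Context {R : realType} (c a t : R) (f : R -> R).
Hypotheses (c0 : 0 < c) (t01 : 0 <= t <= 1).
Hypotheses (mf : measurable_fun (I01 : set (measurableTypeR R)) f).
Hypothesis f0 : forall x, I01 x -> 0 <= f x.

Let subl : `[0, t[ `<=` I01.
Proof. by rewrite (itv01_split _ _ t01); left. Qed.

Let subr : `[t, 1] `<=` I01.
Proof. by rewrite (itv01_split _ _ t01); right. Qed.

Let mI01 : measurable (I01 : set (measurableTypeR R)).
Proof. exact: measurable_itv. Qed.

Let mfl : measurable_fun (`[0, t[ : set (measurableTypeR R)) f.
Proof. exact: measurable_funS mf. Qed.

Let mfr : measurable_fun (`[t, 1] : set (measurableTypeR R)) f.
Proof. exact: measurable_funS mf. Qed.

Let f0l x : `[0, t[%classic x -> 0 <= f x.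
Proof. by move=> /subl /f0. Qed.

Let f0r x : `[t, 1]%classic x -> 0 <= f x.
Proof. by move=> /subr /f0. Qed.

Lemma two_branch_density_ge0 y : 0 <= two_branch_density c a t f y.
Proof.
by apply: addr_ge0; apply: branch_density_ge0; rewrite ?(ltW c0).
Qed.

Lemma measurable_two_branch_density (D : set (measurableTypeR R)) :
  measurable_fun D (two_branch_density c a t f).
Proof. by apply: measurable_funD; exact: measurable_branch_density. Qed.

(** The threshold [t] cuts the domain into two disjoint pieces with one affine branch on each, so
    the integral is a sum of two branch integrals. The conditional is written as in the bodies of
    [S1] and [S2], so that the lemma applies to them directly. *)
Lemma ge0_integral_two_branches (B : set (measurableTypeR R)) : measurable B ->
  (\int[lambda]_(x in I01 `&`
      (fun x => if (x < t)%R then x / c else (x - a) / c)%R @^-1` B) (f x)%:E =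
   \int[lambda]_(x in B) (two_branch_density c a t f x)%:E)%E.
Proof.
move=> mB.
have -> : I01 `&` (fun x => if x < t then x / c else (x - a) / c) @^-1` B =
    (`[0, t[ `&` (fun x => (x - 0) / c) @^-1` B) `|`
    (`[t, 1] `&` (fun x => (x - a) / c) @^-1` B).
  rewrite (itv01_split _ _ t01) setIUl; congr (_ `|` _);
    apply/seteqP; split => x /= []; rewrite in_itv /= => /andP[x1 x2].
  - by rewrite x2 subr0 x1.
  - by rewrite x2 subr0 x1.
  - by rewrite ltNge x1.
  - by rewrite ltNge x1.
have mT b : measurable ((fun x => (x - b) / c)%R @^-1` B).
  rewrite -[X in measurable X]setTI.
  suff: measurable_fun (setT : set (measurableTypeR R))
    (fun x => (x - b) / c : measurableTypeR R) by exact.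
  by apply: measurable_funM => //; exact: measurable_funB.
have sub : (`[0, t[ `&` (fun x => (x - 0) / c) @^-1` B) `|`
    (`[t, 1] `&` (fun x => (x - a) / c) @^-1` B) `<=` I01.
  by move=> x [[/subl]|[/subr]].
rewrite ge0_integral_setU //.
- rewrite !ge0_integral_branch // -?ge0_integralD //.
  + by move=> x _; rewrite lee_fin branch_density_ge0 ?(ltW c0).
  + by apply/measurable_EFinP; exact: measurable_branch_density.
  + by move=> x _; rewrite lee_fin branch_density_ge0 ?(ltW c0).
  + by apply/measurable_EFinP; exact: measurable_branch_density.
- by apply: measurableI; [exact: measurable_itv|exact: mT].
- by apply: measurableI; [exact: measurable_itv|exact: mT].
- by apply/measurable_EFinP; exact: measurable_funS mf.
- by move=> x /sub /f0; rewrite lee_fin.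
- apply/disj_setPS => x [[/= x1 _] [/= x2 _]].
  by move: x1 x2; rewrite !in_itv /= => /andP[_ +] /andP[+ _]; case: ltP.
Qed.
End TwoBranches.

(* The point [y = 1] must be excluded: it is not in the image of the branch of
   [S1] on [0, 1 - a). *)
Lemma two_branch_density_S1 (R : realType) (a y : R) (f : R -> R) :
  0 < a -> a <= 1 / 2 -> 0 <= y < 1 ->
  two_branch_density (1 - a) a (1 - a) f y = (1 - a) *
    (f ((1 - a) * y) +
     \1_(`[(1 - 2 * a) / (1 - a), 1]) y * f ((1 - a) * y + a)).
Proof.
move=> a0 a2 /andP[y0 y1].
have c0 : 0 < 1 - a by lra.
rewrite /two_branch_density /branch_density -mulrDr !patchE addr0 indicE.
rewrite !mem_setE !in_itv /= ler_pdivrMr // (ltW y1) andbT.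
rewrite mulr_ge0 ?(ltW c0) //=.
have -> : (1 - a) * y < 1 - a by nra.
congr (_ * (_ + _)).
have -> : (1 - a) * y + a <= 1 by nra.
(* The point [(1 - a) * y + a] lies in the upper piece [[1 - a, 1]] exactly when [y] reaches
   [(1 - 2 * a) / (1 - a)]; this produces the indicator. *)
rewrite andbT [y * _]mulrC (_ : (1 - a <= _) = (1 - 2 * a <= (1 - a) * y)).
  by case: ifP; rewrite ?mul1r ?mul0r.
by apply/idP/idP; lra.
Qed.

(** Compared with [S1] the branches swap roles: the upper one maps [a,1] onto [0,1] and needs no
    indicator, while the lower one covers only the points below [a / (1 - a)]. *)
Lemma two_branch_density_S2 (R : realType) (a y : R) (f : R -> R) :
  0 < a -> a <= 1 / 2 -> 0 <= y < 1 ->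
  two_branch_density (1 - a) a a f y = (1 - a) *
    (f ((1 - a) * y + a) +
     \1_(`[0, a / (1 - a)[) y * f ((1 - a) * y)).
Proof.
move=> a0 a2 /andP[y0 y1].
have c0 : 0 < 1 - a by lra.
rewrite /two_branch_density /branch_density -mulrDr !patchE addr0 indicE.
rewrite !mem_setE !in_itv /= ltr_pdivlMr // y0 /=.
rewrite mulr_ge0 ?(ltW c0) //= [y * _]mulrC.
have -> : (1 - a) * y + a <= 1 by nra.
have -> : a <= (1 - a) * y + a by nra.
congr (_ * _); rewrite addrC; congr (_ + _).
by case: ifP; rewrite ?mul1r ?mul0r.
Qed.

Theorem lemma1 (R : realType) (a : R) (p alpha1 alpha2 : R -> R)
  (ha0 : 0 < a) (ha : a <= 1 / 2)
  (hp : L1 p) (hp0 : forall x, I01 x -> 0 <= p x)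
  (halpha : weight_functions alpha1 alpha2) :
  let A1 := fun x => alpha1 x * p x in
  let A2 := fun x => alpha2 x * p x in
  let mu := measure_of_density p in
  let mu_S := transformed_measure (S1 a) (S2 a) alpha1 alpha2 p in
  eq_measure01 mu_S mu <->
  {ae lambda, forall x : R, I01 x ->
    A1 ((1 - a) * x)
    + \1_(`[(1 - 2 * a) / (1 - a), 1]) x * A1 ((1 - a) * x + a)
    + A2 ((1 - a) * x + a)
    + \1_(`[0, a / (1 - a)[) x * A2 ((1 - a) * x)
    = p x / (1 - a)}.
Proof.
move=> A1 A2 mu mu_S.
have c0 : 0 < 1 - a by lra.
have [i1 i2 a1_ge0 a2_ge0 _] := halpha.
have mI01 : measurable (I01 : set (measurableTypeR R)) by exact: measurable_itv.
have mL1 f : L1 f -> measurable_fun (I01 : set (measurableTypeR R)) f.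
  by move=> /measurable_int /measurable_EFinP.
have mA1 : measurable_fun (I01 : set (measurableTypeR R)) A1.
  by apply: measurable_funM; exact: mL1.
have mA2 : measurable_fun (I01 : set (measurableTypeR R)) A2.
  by apply: measurable_funM; exact: mL1.
have A1_ge0 x : I01 x -> 0 <= A1 x.
  by move=> Ix; rewrite mulr_ge0 ?a1_ge0 ?hp0.
have A2_ge0 x : I01 x -> 0 <= A2 x.
  by move=> Ix; rewrite mulr_ge0 ?a2_ge0 ?hp0.
have t1 : 0 <= 1 - a <= 1 by lra.
have t2 : 0 <= a <= 1 by lra.
pose g1 := two_branch_density (1 - a) a (1 - a) A1.
pose g2 := two_branch_density (1 - a) a a A2.
pose g x := g1 x + g2 x.
have mg (D : set (measurableTypeR R)) : measurable_fun D g.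
  by apply: measurable_funD; exact: measurable_two_branch_density.
have mu_SE (B : set (measurableTypeR R)) : measurable B ->
    mu_S B = (\int[lambda]_(x in B) (g x)%:E)%E.
  move=> mB; rewrite /mu_S /transformed_measure !ge0_integral_two_branches //.
  rewrite -ge0_integralD //.
  - by move=> x _; rewrite lee_fin two_branch_density_ge0.
  - by apply/measurable_EFinP; exact: measurable_two_branch_density.
  - by move=> x _; rewrite lee_fin two_branch_density_ge0.
  - by apply/measurable_EFinP; exact: measurable_two_branch_density.
(* Away from 1, [g y] is [1 - a] times the left-hand side, and [1 - a] is positive and can be
   divided out. *)
have gE y : I01 y -> y != 1 -> (g y = p y) <->
    A1 ((1 - a) * y)
    + \1_(`[(1 - 2 * a) / (1 - a), 1]) y * A1 ((1 - a) * y + a)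
    + A2 ((1 - a) * y + a)
    + \1_(`[0, a / (1 - a)[) y * A2 ((1 - a) * y)
    = p y / (1 - a).
  rewrite /I01 /= in_itv /= => /andP[y0 y1] yn1.
  have y01 : 0 <= y < 1 by rewrite y0 lt_neqAle yn1.
  rewrite /g /g1 /g2 two_branch_density_S1 // two_branch_density_S2 //.
  rewrite -mulrDr !addrA; split=> [<-|->].
    by rewrite [RHS]mulrAC divff ?mul1r ?gt_eqF.
  by rewrite [LHS]mulrC divfK ?gt_eqF.
have ae_neq1 : {ae @lambda R, forall x : R, x != 1}.
  exists [set 1]; split => //; first exact: lebesgue_measure_set1.
  by move=> x /= /negP; rewrite negbK => /eqP.
(* Densities with equal integrals over all Borel subsets agree almost everywhere. [p] stands first
   because [integral_ae_eq] asks for integrability of its first function, which [hp] provides; for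
   [g] measurability is enough. *)
have -> : eq_measure01 mu_S mu <->
    ae_eq lambda I01 (EFin \o p) (EFin \o g).
  split=> [eqmu|pg B mB BI].
    apply: integral_ae_eq => // [|E EI mE]; first exact/measurable_EFinP.
    by rewrite -[LHS]eqmu // mu_SE.
  rewrite mu_SE // /mu /measure_of_density; apply/esym/ae_eq_integral => //.
  - by apply/measurable_EFinP; apply: measurable_funS (mL1 _ hp).
  - exact/measurable_EFinP.
  - exact: ae_eq_subset pg.
have F := ae_filter_ringOfSetsType (@lambda R).
(* Each direction discards the null set {1} and applies [gE] at the remaining points. *)
split; apply: (@filterS2 _ _ F _ _ _ _ ae_neq1) => x xn1 h Ix.
  by apply/gE => //; case: (h Ix).
by congr EFin; apply/esym/gE => //; exact: h.
Qed.
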